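(* Let $\lambda\vdash n$ have exactly $k$ parts equal to $1$. Then for all $j=0,\dots,n-k$, $Q_{\lambda,j}=Q_{\lambda,n-k-j}$.
   Context: For $\sigma\in\mathfrak S_n$ in one-line notation $\sigma_1\cdots\sigma_n$, $\mathrm{Exc}(\sigma)=\{i\in[n-1]:\sigma_i>i\}$, $\mathrm{exc}=|\mathrm{Exc}|$. Order $\bar1<\dots<\bar n<1<\dots<n$; $\bar\sigma$ is $\sigma$ with $\sigma_i$ barred for $i\in\mathrm{Exc}(\sigma)$; $\mathrm{Exd}(\sigma)=\{i\in[n-1]:\bar\sigma_i>\bar\sigma_{i+1}\}$. $F_{S,n}=\sum x_{i_1}\cdots x_{i_n}$ over $i_1\ge\dots\ge i_n\ge1$ with $i_j>i_{j+1}$ for $j\in S$. $Q_{\lambda,j}=\sum F_{\mathrm{Exd}(\sigma),n}$ over $\sigma\in\mathfrak S_n$ of cycle type $\lambda$ with $\mathrm{exc}(\sigma)=j$ (an empty sum is $0$). *)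

(* Defs.v *)
From HB Require Import structures.
From mathcomp Require Import all_boot all_order all_algebra all_fingroup.
From mathcomp Require Import finmap multiset.

Set Implicit Arguments.
Unset Strict Implicit.
Unset Printing Implicit Defensive.

Import Order.TTheory GRing.Theory.

(* The monomial x_{i_1} ... x_{i_l} is the multiset {i_1, ..., i_l}; a formal
   power series over Z in infinitely many variables maps each monomial to its
   coefficient.  Variables are indexed from 1, so x_0 never occurs below. *)
Notation monomial := {mset nat}%mset.
Definition pseries := monomial -> int.

(* The words (i_1, ..., i_l) with x_{i_1} ... x_{i_l} = m are exactly the
   members of the duplicate-free list [permutations m]. *)
Lemma mem_permutations_monomial (m : monomial) (s : seq nat) :
  (s \in permutations m) = (seq_mset s == m).
Proof.
rewrite mem_permutations -{2}[m]seq_mset_id.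
by apply/idP/eqP => /eq_seq_msetP.
Qed.

(* The formal sum of x_{i_1} ... x_{i_l} over all words satisfying A. *)
Definition sum_monomials (A : pred (seq nat)) : pseries :=
  fun m => Posz (count A (permutations m)).

(* Positions in [n-1] are elements of 'I_n.-1 and positions and values in [n]
   are elements of 'I_n, both shifted down by one. *)
Lemma pos_succ_subproof n (i : 'I_n.-1) : i.+1 < n.
Proof. by case: n i => [|n] [i]. Qed.

Definition pos n (i : 'I_n.-1) : 'I_n := widen_ord (leq_pred n) i.
Definition pos_succ n (i : 'I_n.-1) : 'I_n := Ordinal (pos_succ_subproof i).

Definition F_index n (S : {set 'I_n.-1}) (s : seq nat) : bool :=
  [&& size s == n, sorted geq s, all (leq 1) s &
      [forall i in S, nth 0 s (pos_succ i) < nth 0 s (pos i)]].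

Definition F n (S : {set 'I_n.-1}) : pseries := sum_monomials (F_index S).

Definition Exc n (sigma : 'S_n) : {set 'I_n.-1} :=
  [set i : 'I_n.-1 | pos i < sigma (pos i)].

Definition exc n (sigma : 'S_n) : nat := #|Exc sigma|.

(* The letter a is (true, a) and the barred letter a is (false, a), so that the
   lexicographic order puts all barred letters first. *)
Definition barred n (sigma : 'S_n) (i : 'I_n) : bool *l 'I_n :=
  (i \notin [set pos e | e in Exc sigma], sigma i).

Definition Exd n (sigma : 'S_n) : {set 'I_n.-1} :=
  [set i : 'I_n.-1 | (barred sigma (pos_succ i) < barred sigma (pos i))%O].

Definition is_partition (n : nat) (la : seq nat) : bool :=
  [&& sorted geq la, all (leq 1) la & sumn la == n].

Definition cycle_type n (sigma : 'S_n) : seq nat :=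
  sort geq [seq #|C| | C : {set 'I_n} <- enum (porbits sigma)].

Definition Q (n : nat) (la : seq nat) (j : nat) : pseries :=
  fun m => (\sum_(sigma : 'S_n | (cycle_type sigma == la) && (exc sigma == j))
              F (Exd sigma) m)%R.

(* Main.v *)
(* Fix a monomial with indices s_1 >= ... >= s_n.  A permutation sigma
   contributes to its coefficient iff s is strictly decreasing at Exd sigma;
   equivalently, the positions 1, ..., n are sorted by the infinite words read
   along the cycles of sigma in the letters (s_i, excedance or not), and
   positions with equal words keep their order under sigma (the
   Gessel-Reutenauer correspondence with multisets of necklaces).  Reversing all
   the necklaces gives the bijection: take sigma^-1, which has the same cycle
   type and one excedance for each of the n - k - j antiexcedances of sigma, and
   conjugate it by the permutation that sorts the positions by the words of
   sigma^-1, breaking ties by the original order. *)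
Require Import Defs.
From mathcomp Require Import all_boot order all_fingroup ssrint multiset zify.
From Stdlib Require Import FunctionalExtensionality.

Set Implicit Arguments.
Unset Strict Implicit.
Unset Printing Implicit Defensive.

(** * Periodic words encoded as numbers *)

Section PeriodicWords.

Variables (T : Type) (p : T -> T) (l : T -> nat) (b : nat).

(* The number with base [b] digits [l x], [l (p x)], ..., [l (p^(N-1) x)]: when
   [p^N] is the identity, comparing these numbers amounts to comparing the
   infinite words [l x, l (p x), ...] lexicographically. *)
Fixpoint word_value N x :=
  if N is N'.+1 then l x * b ^ N' + word_value N' (p x) else 0.

Lemma word_valueSr N x :
  word_value N.+1 x = word_value N x * b + l (iter N p x).
Proof.
elim: N x => [|N IHN] x /=; first by rewrite expn0 muln1 addn0.
by rewrite -[_ + word_value N _]/(word_value N.+1 (p x)) IHN -iterSr expnSr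
  mulnDl mulnA addnA.
Qed.

Hypothesis l_lt_b : forall x, l x < b.

Lemma word_value_lt N x : word_value N x < b ^ N.
Proof.
elim: N x => [|N IHN] x //=.
have := IHN (p x); have := l_lt_b x; rewrite expnS; nia.
Qed.

Variable N : nat.
Hypotheses (N_gt0 : 0 < N) (iter_N : forall x, iter N p x = x).

Lemma word_value_letter x y :
  l x < l y -> word_value N x < word_value N y.
Proof.
case: N N_gt0 => // N' _ /= lt_xy.
have := word_value_lt N' (p x); nia.
Qed.

(** By periodicity the digit at place [N] is [l x] again, so one digit of the [N.+1] read from [x]
    can be split off at either end. *)
Lemma word_value_shift x :
  word_value N x * b + l x = l x * b ^ N + word_value N (p x).
Proof. by rewrite -{2}(iter_N x) -word_valueSr. Qed.

Lemma leq_word_value_letter x y :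
  word_value N x <= word_value N y -> l x <= l y.
Proof. by apply: contraLR; rewrite -!ltnNge; apply: word_value_letter. Qed.

Lemma eq_word_valueP x y :
  word_value N x = word_value N y ->
  l x = l y /\ word_value N (p x) = word_value N (p y).
Proof.
move=> e; have el: l x = l y.
  by apply/eqP; rewrite eqn_leq !leq_word_value_letter ?e.
split=> //; have := word_value_shift x; have := word_value_shift y.
rewrite e el; lia.
Qed.

Hypothesis b_gt1 : 1 < b.

(** Subtracting the shift identities of [x] and [y] cancels the common letter: the gap is multiplied
    by exactly [b]. *)
Lemma ltn_word_value_shift x y : l x = l y -> word_value N x < word_value N y ->
  word_value N y - word_value N x < word_value N (p y) - word_value N (p x).
Proof.
move=> el; have := word_value_shift x; have := word_value_shift y; rewrite el.
nia.
Qed.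

End PeriodicWords.

Lemma eq_word_value (T U : Type) (h : T -> U) p q l l' b N x :
  (forall y, h (p y) = q (h y)) -> (forall y, l y = l' (h y)) ->
  word_value p l b N x = word_value q l' b N (h x).
Proof.
by move=> hp hl; elim: N x => //= N IHN x; rewrite IHN hp hl.
Qed.

Lemma no_infinite_descent (T : Type) (P : T -> Prop) (p : T -> T)
    (m : T -> nat) :
  (forall x, P x -> P (p x) /\ m (p x) < m x) -> forall x, ~ P x.
Proof.
move=> desc x; have [k] := ubnP (m x); elim: k x => // k IHk x.
by move=> le_mk /desc[/IHk Ppx lt_m]; apply: Ppx; lia.
Qed.

Lemma increasing_perm n (t : 'S_n) :
  (forall i j : 'I_n, i < j -> t i < t j) -> t = 1%g.
Proof.
move=> incr_t; apply/permP => i; rewrite perm1; apply/eqP; rewrite -val_eqE /=.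
case: ltngtP => // lt_i; exfalso; move: i lt_i.
  apply: (no_infinite_descent (p := t) (m := val)) => i lt_i.
  by split=> //; apply: incr_t.
apply: (no_infinite_descent (p := t) (m := fun i : 'I_n => n - i)) => i lt_i.
by split; [apply: incr_t | have := ltn_ord (t i); lia].
Qed.

(** * Sorting positions by their words, and the resulting injection *)

Section Resorting.

Variables (n : nat) (f : 'I_n -> nat).
Hypothesis f_mono : forall i j : 'I_n, i <= j -> f i <= f j.

Implicit Types (p s t : 'S_n) (i j : 'I_n).

(* Even letters are the excedances, that is, the barred letters. *)
Definition letter p i : nat := (f i).*2 + ~~ (i < p i).

Definition base := (\max_i f i).*2.+2.

(** The group order is a multiple of every element order, so one length serves [p], [p^-1] and their
    conjugates. *)
Definition value p i : nat := word_value p (letter p) base #|'S_n| i.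

(* When [f] encodes the indices of a monomial, this says that the monomial
   occurs in [F (Exd p)] (see [F_index_compatible]), for all pairs of positions
   at once instead of only the adjacent ones. *)
Definition compatible p :=
  forall i j, i < j ->
    letter p i < letter p j \/ letter p i = letter p j /\ p i < p j.

Lemma letter_lt_base p i : letter p i < base.
Proof.
have := leq_bigmax i (F := f); rewrite /letter /base; case: (i < p i); lia.
Qed.

Lemma iter_card_perm p i : iter #|'S_n| p i = i.
Proof.
have /dvdnP[k ->] : #[p]%g %| #|'S_n| by rewrite -cardsT cardSg ?subsetT.
by rewrite -permX mulnC expgM expg_order expg1n perm1.
Qed.

Lemma card_perm_gt0 : 0 < #|'S_n|.
Proof. by rewrite -cardsT cardG_gt0. Qed.

Lemma value_letter p i j : letter p i < letter p j -> value p i < value p j.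
Proof. exact: (word_value_letter p (letter_lt_base p) card_perm_gt0). Qed.

Lemma leq_value_letter p i j :
  value p i <= value p j -> letter p i <= letter p j.
Proof. by apply: contraLR; rewrite -!ltnNge; apply: value_letter. Qed.

Lemma eq_valueP p i j : value p i = value p j ->
  letter p i = letter p j /\ value p (p i) = value p (p j).
Proof.
exact: (eq_word_valueP (letter_lt_base p) card_perm_gt0 (iter_card_perm p)).
Qed.

Lemma ltn_value_shift p i j :
  letter p i = letter p j -> value p i < value p j ->
  value p j - value p i < value p (p j) - value p (p i).
Proof.
by apply: ltn_word_value_shift card_perm_gt0 (iter_card_perm p) _ _ _ => //.
Qed.

Lemma letter_inj p i j : letter p i = letter p j ->
  f i = f j /\ (i < p i) = (j < p j).
Proof. by rewrite /letter; case: (i < p i); case: (j < p j) => /=; lia. Qed.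

(** Otherwise the letter of [p i] is at most that of [i]; as [f] is monotone and excedances have
    even letters, the letters agree and [p i] is an excedance too. The values would then fall
    forever along the cycle. *)
Lemma value_exc p i : i < p i -> value p i <= value p (p i).
Proof.
move=> lt_i; rewrite leqNgt; apply/negP => lt_v.
pose P i := i < p i /\ value p (p i) < value p i.
apply: (@no_infinite_descent _ P p (value p) _ i) => //.
move=> {lt_i lt_v}x [lt_x lt_v].
split=> //.
have le_l := leq_value_letter (ltnW lt_v).
have le_f := f_mono (ltnW lt_x).
have el : letter p (p x) = letter p x.
  by move: le_l; rewrite /letter lt_x; case: (p x < _); lia.
have [_ e] := letter_inj el; split; first by rewrite e.
by have := ltn_value_shift el lt_v; lia.
Qed.

Lemma value_antiexc p i : p i < i -> value p (p i) <= value p i.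
Proof.
move=> lt_i; rewrite leqNgt; apply/negP => lt_v.
pose P i := p i < i /\ value p i < value p (p i).
apply: (@no_infinite_descent _ P p val _ i) => // {lt_i lt_v}x [lt_x lt_v].
split=> //.
have le_l := leq_value_letter (ltnW lt_v).
have le_f := f_mono (ltnW lt_x).
have el : letter p x = letter p (p x).
  by move: le_l; rewrite /letter ltnNge (ltnW lt_x) /=; case: (_ < _); lia.
have lt_v' : value p (p x) < value p (p (p x)).
  by have := ltn_value_shift el lt_v; lia.
have [_ e] := letter_inj el; split=> //.
(* Equal letters only give [p (p x) <= p x]; the differing values exclude equality. *)
have : p (p x) != p x by apply: contraTneq lt_v' => ->; rewrite ltnn.
by rewrite -val_eqE /=; move: e; lia.
Qed.

Definition tied p i j := value p i = value p j.

Lemma tied_iter p i j k : tied p i j -> tied p ((p ^+ k)%g i) ((p ^+ k)%g j).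
Proof.
rewrite !permX => tij; elim: k => //= k IHk; by case: (eq_valueP IHk).
Qed.

Lemma tied_inv p i j : tied p i j -> tied p (p^-1%g i) (p^-1%g j).
Proof. by rewrite invg_expg; apply: tied_iter. Qed.

(** The word at [i] repeats one non-excedance letter, so the cycle of [j] has no excedance, and a
    strict descent on it would never end. *)
Lemma tied_fixed p i j : tied p i j -> p i = i -> p j = j.
Proof.
move=> tij fix_i; have fixed x : tied p i x -> p x <= x.
  by case/eq_valueP=> /letter_inj[_]; rewrite fix_i ltnn; lia.
apply/eqP; rewrite -val_eqE /= eqn_leq fixed //= leqNgt; apply/negP => lt_j.
pose P x := tied p i x /\ p x < x.
apply: (@no_infinite_descent _ P p val _ j) => // {tij lt_j}x [tix lt_x].
have tipx : tied p i (p x) by case: (eq_valueP tix); rewrite fix_i.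
do 2!split=> //; rewrite ltn_neqAle fixed // andbT.
by apply: contraTneq lt_x => /val_inj/perm_inj->; rewrite ltnn.
Qed.

(* Inverting [p] exchanges excedances and antiexcedances and leaves the fixed
   points alone, so the words of [p^-1] are determined by those of [p]. *)
Lemma tied_letter_inv p i j : tied p i j -> letter p^-1 i = letter p^-1 j.
Proof.
move=> tij; have /letter_inj[ef _] := (eq_valueP tij).1.
rewrite /letter ef; congr (_ + ~~ _).
set x := p^-1%g i; set y := p^-1%g j.
have txy : tied p x y by apply: tied_inv.
have [/letter_inj[_ exc_xy] _] := eq_valueP txy.
have fix_xy : (p x == x) = (p y == y).
  by apply/eqP/eqP; apply: tied_fixed.
rewrite -{1}[i](permKV p) -/x -{1}[j](permKV p) -/y.
by move: fix_xy exc_xy; rewrite -!val_eqE /=; lia.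
Qed.

Lemma tied_invP p i j : tied p^-1 i j <-> tied p i j.
Proof.
wlog suff imp : p / tied p i j -> tied p^-1 i j.
  by split; [rewrite -{2}[p]invgK|]; apply: imp.
move=> tij; rewrite /tied /value; elim: #|_| i j tij => //= N IHN i j tij.
by rewrite (tied_letter_inv tij); congr (_ + _); apply: IHN; apply: tied_inv.
Qed.

(** This order makes [rank] the stable sort of the positions by their words. *)
Definition precedes p i j :=
  (value p i < value p j) || (value p i == value p j) && (i < j).

(* If a smaller position had a larger word, then along [p] the gap between the
   two values would grow forever. *)
Lemma compatible_value p i j : compatible p -> i < j -> value p i <= value p j.
Proof.
move=> cp lt_ij; rewrite leqNgt; apply/negP => lt_v.
pose P (x : 'I_n * 'I_n) := x.1 < x.2 /\ value p x.2 < value p x.1.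
pose m (x : 'I_n * 'I_n) := base ^ #|'S_n| - (value p x.1 - value p x.2).
apply: (@no_infinite_descent _ P (fun x => (p x.1, p x.2)) m _ (i, j)) => //.
move=> {lt_ij lt_v} [x y] [/= lt_xy lt_v].
have [/value_letter|[el lt_p]] := cp _ _ lt_xy; first by lia.
have := ltn_value_shift (esym el) lt_v.
have : value p (p x) < base ^ #|'S_n| by apply/word_value_lt/letter_lt_base.
rewrite /P /m /=; lia.
Qed.

Lemma compatible_precedes p i j : compatible p -> precedes p i j = (i < j).
Proof.
move=> cp; apply/idP/idP => [|lt_ij]; rewrite /precedes.
  case/orP=> [lt_v|/andP[]//]; rewrite ltnNge leq_eqVlt.
  apply/negP => /predU1P[].
    by move/val_inj=> E; rewrite E ltnn in lt_v.
  by move/(compatible_value cp); lia.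
by have := compatible_value cp lt_ij; lia.
Qed.

Lemma card_precedes_lt p i : #|[set j | precedes p j i]| < n.
Proof.
rewrite -[X in _ < X]card_ord; apply: (@leq_trans #|[set~ i]|.+1).
  rewrite ltnS; apply/subset_leq_card/subsetP => j; rewrite !inE.
  by apply: contraTneq => ->; rewrite /precedes !ltnn andbF.
by rewrite cardsC1 prednK // card_ord; case: i => [[]]; lia.
Qed.

Definition rank_ord p i : 'I_n := Ordinal (card_precedes_lt p i).

Lemma ltn_rank_ord p i j : precedes p i j -> rank_ord p i < rank_ord p j.
Proof.
move=> pij; apply: proper_card; apply/properP; split.
  apply/subsetP => x; rewrite !inE; move: pij; rewrite /precedes; lia.
by exists i; rewrite !inE // /precedes !ltnn andbF.
Qed.

Lemma precedes_total p i j : i != j -> precedes p i j || precedes p j i.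
Proof. by rewrite /precedes -val_eqE /=; lia. Qed.

Lemma rank_ord_inj p : injective (rank_ord p).
Proof.
move=> i j e; apply/eqP; apply/negPn/negP => /(precedes_total p).
by case/orP=> /ltn_rank_ord; rewrite e ltnn.
Qed.

Definition rank p : 'S_n := perm (@rank_ord_inj p).

Lemma rank_lt p i j : (rank p i < rank p j) = precedes p i j.
Proof.
rewrite !permE; apply/idP/idP => [|/ltn_rank_ord//].
have [->|/(precedes_total p)/orP[//|/ltn_rank_ord]] := eqVneq i j.
  by rewrite ltnn.
lia.
Qed.

Lemma ltn_value_f p i j : f i < f j -> value p i < value p j.
Proof. by move=> lt_f; apply: value_letter; rewrite /letter; lia. Qed.

(** The first letter dominates a word, so [rank p] also sorts by [f]; but [f] is already sorted, and
    a sorted rearrangement is unique. *)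
Lemma f_rank p i : f (rank p i) = f i.
Proof.
have le_g : forall i j : 'I_n, i <= j ->
    f ((rank p)^-1%g i) <= f ((rank p)^-1%g j).
  move=> x y le_xy; rewrite leqNgt; apply/negP => /(ltn_value_f p) lt_v.
  have : precedes p ((rank p)^-1%g y) ((rank p)^-1%g x).
    by rewrite /precedes lt_v.
  by rewrite -rank_lt !permKV; lia.
have sorted_ord (g : 'I_n -> nat) : (forall i j : 'I_n, i <= j -> g i <= g j) ->
    sorted leq (map g (enum 'I_n)).
  move=> mono_g; rewrite sorted_map; apply: (@sub_sorted _ (relpre val leq)).
    by move=> x y; apply: mono_g.
  by rewrite -sorted_map val_enum_ord iota_sorted.
have : map f (enum 'I_n) = map (fun i => f ((rank p)^-1%g i)) (enum 'I_n).
  apply: (sorted_eq leq_trans anti_leq); rewrite ?sorted_ord //.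
  rewrite perm_sym (map_comp f (rank p)^-1%g).
  apply: perm_map; apply: uniq_perm.
  - by rewrite map_inj_uniq ?enum_uniq //; apply: perm_inj.
  - exact: enum_uniq.
  move=> x; rewrite mem_enum; apply/mapP.
  exists (rank p x); rewrite ?mem_enum //.
  by rewrite permK.
by move/eq_in_map/(_ (rank p i)); rewrite permK => -> //; rewrite mem_enum.
Qed.

Lemma exc_rank p i : (rank p i < rank p (p i)) = (i < p i).
Proof.
rewrite rank_lt; have [lt_i|lt_i|/val_inj <-] := ltngtP i (p i).
- by rewrite /precedes lt_i andbT orbC -leq_eqVlt value_exc.
- by have := value_antiexc lt_i; rewrite /precedes; lia.
- by rewrite /precedes !ltnn andbF.
Qed.

Lemma letter_rank p i : letter (p ^ rank p)%g (rank p i) = letter p i.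
Proof. by rewrite /letter permJ exc_rank f_rank. Qed.

Definition flip p : 'S_n := (p^-1 ^ rank p^-1)%g.

Lemma tied_ltn p i j : compatible p -> tied p i j -> i < j -> p i < p j.
Proof.
move=> cp tij lt_ij; have [el _] := eq_valueP tij.
by case: (cp _ _ lt_ij) => [|[]//]; rewrite el ltnn.
Qed.

Lemma tied_ltn_inv p i j :
  compatible p -> tied p i j -> i < j -> p^-1%g i < p^-1%g j.
Proof.
move=> cp /tied_inv tij lt_ij; rewrite ltnNge leq_eqVlt; apply/negP.
case/predU1P=> [/val_inj/perm_inj E | lt_p]; first by rewrite E ltnn in lt_ij.
by have := tied_ltn cp (esym tij) lt_p; rewrite !permKV; lia.
Qed.

(** For equal first letters, distinct words keep their order after a shift because the gap grows;
    equal words are ordered by position, which [p^-1] respects on ties. *)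
Lemma compatible_flip p : compatible p -> compatible (flip p).
Proof.
move=> cp x y; set t := rank p^-1.
rewrite -[x](permKV t) -[y](permKV t); move: (t^-1%g x) (t^-1%g y) => i j.
rewrite !letter_rank !permJ !rank_lt => /orP[lt_v | /andP[/eqP tij lt_ij]].
  have := leq_value_letter (ltnW lt_v); rewrite leq_eqVlt.
  case/predU1P=> [el|]; last by left.
  by right; split=> //; have := ltn_value_shift el lt_v; rewrite /precedes; lia.
have [el tpij] := eq_valueP tij; right; split=> //.
rewrite /precedes tpij ltnn eqxx /=.
by apply: tied_ltn_inv => //; apply/tied_invP.
Qed.

Lemma value_conj p t :
    (forall i, letter (p ^ t)%g (t i) = letter p i) ->
  forall i, value (p ^ t)%g (t i) = value p i.
Proof.
by move=> l_t i; apply/esym/eq_word_value => j; rewrite ?permJ ?l_t.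
Qed.

(** Compatibility sorts the positions of both permutations by word; [t] preserves the words and the
    order within ties, so it is increasing. *)
Lemma compatible_conj p t :
    compatible p -> compatible (p ^ t)%g ->
    (forall i, letter (p ^ t)%g (t i) = letter p i) ->
    (forall i j : 'I_n, tied p i j -> i < j -> t i < t j) ->
  t = 1%g.
Proof.
move=> cp cq l_t tied_t.
have val_t := value_conj l_t.
apply: increasing_perm => i j lt_ij; rewrite -(compatible_precedes _ _ cq).
have := compatible_value cp lt_ij; rewrite leq_eqVlt => /predU1P[tij | lt_v].
  by rewrite /precedes !val_t tij ltnn eqxx tied_t.
by rewrite /precedes !val_t lt_v.
Qed.

Lemma exc_rank_inv p i : (rank p^-1 i < rank p^-1 (p i)) = (i < p i).
Proof.
have := exc_rank p^-1 (p i); rewrite permK => e.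
have : (rank p^-1 i == rank p^-1 (p i)) = (i == p i).
  exact: (inj_eq (@perm_inj _ (rank p^-1))).
by rewrite -!val_eqE /=; lia.
Qed.

Lemma letter_flip_inv p i : letter (flip p)^-1 (rank p^-1 i) = letter p i.
Proof. by rewrite /letter /flip -conjVg invgK permJ exc_rank_inv f_rank. Qed.

Lemma flip_inj p q : compatible p -> compatible q -> flip p = flip q -> p = q.
Proof.
(* [t] relabels the positions of [p] as those of [q] by passing through the common flip. *)
move=> cp cq eq_flip; pose t := (rank p^-1 * (rank q^-1)^-1)%g.
have rank_t i : rank q^-1 (t i) = rank p^-1 i by rewrite permM permKV.
have conj_t : (p ^ t)%g = q.
  apply: invg_inj; rewrite -conjVg conjgM.
  by rewrite -[((p^-1) ^ _)%g]/(flip p) eq_flip -conjgM mulgV conjg1.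
have l_t i : letter q (t i) = letter p i.
  by rewrite -letter_flip_inv rank_t -eq_flip letter_flip_inv.
suff t1 : t = 1%g by rewrite -conj_t t1 conjg1.
apply: (compatible_conj cp); rewrite ?conj_t // => i j tij lt_ij.
have tij' : tied q (t i) (t j).
  by rewrite /tied -conj_t !value_conj // => x; rewrite conj_t.
have : rank q^-1 (t i) < rank q^-1 (t j).
  rewrite !rank_t rank_lt /precedes lt_ij.
  by rewrite ((tied_invP _ _ _).2 tij) eqxx orbT.
by rewrite rank_lt /precedes ((tied_invP _ _ _).2 tij') ltnn eqxx.
Qed.

(** An antiexcedance [i] of [p] gives the excedance [p i] of [p^-1], and sorting by [rank p^-1]
    keeps excedances. *)
Lemma card_exc_flip p :
  #|[set i : 'I_n | i < flip p i]| = #|[set i | p i < i]|.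
Proof.
have -> : [set i : 'I_n | i < flip p i] =
    (p * rank p^-1)%g @: [set i | p i < i].
  apply/setP => x; rewrite -[x](permKV (p * rank p^-1)%g).
  rewrite mem_imset; last exact: perm_inj.
  by rewrite !inE permM /flip permJ exc_rank permK.
by rewrite card_imset //; apply: perm_inj.
Qed.

End Resorting.

(** * Cycle type, fixed points and excedances *)

Section CycleType.

Variable n : nat.
Implicit Types s t : 'S_n.

Lemma porbitJ s t i : porbit (s ^ t)%g (t i) = t @: porbit s i.
Proof.
apply/setP=> x; apply/porbitP/imsetP => [[k ->]|[y /porbitP[k ->] ->]].
  by exists ((s ^+ k)%g i); rewrite ?mem_porbit // -conjXg permJ.
by exists k; rewrite -conjXg permJ.
Qed.

Lemma porbitsJ s t :
  porbits (s ^ t)%g = [set t @: C | C : {set 'I_n} in porbits s].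
Proof.
apply/setP=> C; apply/imsetP/imsetP => [[x _ ->]|[_ /imsetP[i _ ->] ->]].
  by exists (porbit s (t^-1%g x)); rewrite ?imset_f // -porbitJ permKV.
by exists (t i); rewrite // porbitJ.
Qed.

Lemma cycle_typeV s : cycle_type s^-1 = cycle_type s.
Proof. by rewrite /cycle_type porbitsV. Qed.

Lemma cycle_typeJ s t : cycle_type (s ^ t)%g = cycle_type s.
Proof.
apply/perm_sortP; try by [move=> x y; lia | move=> x y z; lia].
have inj_t : injective (fun C : {set 'I_n} => t @: C).
  by apply/imset_inj/perm_inj.
have /(perm_map (fun C : {set 'I_n} => #|C|)) :
    perm_eq (enum (porbits (s ^ t)%g))
      [seq t @: C | C : {set 'I_n} <- enum (porbits s)].
  apply: uniq_perm; rewrite ?map_inj_uniq ?enum_uniq // => C.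
  rewrite mem_enum porbitsJ; apply/imsetP/mapP => -[D sD ->]; exists D => //.
    by rewrite mem_enum.
  by rewrite -mem_enum.
move/perm_trans; apply; rewrite -map_comp.
rewrite (@eq_map _ _ _ (fun C : {set 'I_n} => #|C|)) //.
by move=> C; rewrite /= card_imset //; apply: perm_inj.
Qed.

Lemma count1_cycle_type s : count_mem 1 (cycle_type s) = #|[set i | s i == i]|.
Proof.
rewrite /cycle_type count_sort count_map -size_filter.
rewrite -(card_uniqP (filter_uniq _ (enum_uniq _))).
rewrite -[RHS](card_imset _ set1_inj); apply: eq_card => C.
rewrite mem_filter mem_enum /=; apply/andP/imsetP => [[]|[i]].
  move=> /cards1P[i defC] /imsetP[j _ defC'].
  exists i => //; rewrite inE.
  have ij : i = j by apply/esym/set1P; rewrite -defC defC' porbit_id.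
  by rewrite -in_set1 -defC defC' -ij -{1}[s]expg1 mem_porbit.
rewrite inE => /eqP fix_i ->; rewrite cards1 eqxx; split=> //.
apply/imsetP; exists i => //; apply/setP=> x; rewrite inE.
apply/eqP/porbitP => [->|[k ->]]; first by exists 0; rewrite expg0 perm1.
by rewrite permX; elim: k => //= k ->.
Qed.

Lemma card_exc_antiexc s :
  #|[set i : 'I_n | i < s i]| + #|[set i | s i < i]| =
  n - count_mem 1 (cycle_type s).
Proof.
rewrite count1_cycle_type.
set E := [set i : 'I_n | i < s i]; set A := [set i | s i < i].
have -> : [set i | s i == i] = ~: (E :|: A).
  by apply/setP => i; rewrite !inE -val_eqE /=; lia.
have disj : E :&: A = set0 by apply/setP => i; rewrite !inE; lia.
have -> : #|E| + #|A| = #|E :|: A| by rewrite cardsU disj cards0 subn0.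
by rewrite -[X in X - _]card_ord -(cardsC (E :|: A)) addnK.
Qed.

Lemma pos_inj : injective (@pos n).
Proof. by move=> i j /(congr1 val) /= /val_inj. Qed.

(** The last position is never an excedance. *)
Lemma excE s : exc s = #|[set i : 'I_n | i < s i]|.
Proof.
rewrite /exc -(card_imset (Exc s) pos_inj).
apply: eq_card => i; rewrite [RHS]inE; apply/imsetP/idP => [[e]|lt_i].
  by rewrite inE => lt_e ->.
have lt_in : i < n.-1 by have := ltn_ord (s i); lia.
have defi : i = pos (Ordinal lt_in) by apply: val_inj.
by exists (Ordinal lt_in); rewrite // inE -defi.
Qed.

End CycleType.

(** * From descent conditions on monomials to compatibility *)

Section Compatibility.

Variables (n : nat) (s : seq nat).
Hypotheses (size_s : size s = n) (sorted_s : sorted geq s).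

(* [F_index] uses weakly decreasing words, whereas [letter] wants a weakly
   increasing function. *)
Definition depth (i : 'I_n) : nat := nth 0 s 0 - nth 0 s i.

Lemma geq_nth i j : i <= j -> j < n -> nth 0 s j <= nth 0 s i.
Proof.
move=> le_ij lt_j; have geq_trans : transitive geq by move=> x y z; lia.
apply: (sorted_leq_nth geq_trans leqnn 0 sorted_s) => //.
  by rewrite inE size_s; lia.
by rewrite inE size_s.
Qed.

Lemma depth_mono (i j : 'I_n) : i <= j -> depth i <= depth j.
Proof. by move=> le_ij; apply: leq_sub2l; apply: geq_nth. Qed.

Lemma depth_lt (i j : 'I_n) : (depth i < depth j) = (nth 0 s j < nth 0 s i).
Proof.
have := geq_nth (leq0n i) (ltn_ord i); have := geq_nth (leq0n j) (ltn_ord j).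
rewrite /depth; lia.
Qed.

Lemma barred_lt (p : 'S_n) (i j : 'I_n) : (barred p i < barred p j)%O =
  (i < p i) && ~~ (j < p j) || ((i < p i) == (j < p j)) && (p i < p j).
Proof.
have excP x : (x \in [set pos e | e in Exc p]) = (x < p x).
  apply/imsetP/idP => [[e]|lt_x]; first by rewrite inE => lt_e ->.
  have lt_xn : x < n.-1 by have := ltn_ord (p x); lia.
  have defx : x = pos (Ordinal lt_xn) by apply: val_inj.
  by exists (Ordinal lt_xn); rewrite // inE -defx.
rewrite /barred !excP Order.ProdLexiOrder.ltEprodlexi /=.
by case: (i < p i); case: (j < p j).
Qed.

Lemma F_index_compatible (p : 'S_n) : all (leq 1) s ->
  F_index (Exd p) s <-> compatible depth p.
Proof.
move=> s_gt0; rewrite /F_index size_s eqxx sorted_s s_gt0 /=; split.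
  pose before i j := letter depth p i < letter depth p j
    \/ letter depth p i = letter depth p j /\ p i < p j.
  move/forall_inP => desc i j; rewrite -/(before i j).
  (* Off [Exd p] the barred letters ascend; on it the depth strictly increases. *)
  have adj e : before (pos e) (pos_succ e).
    have le_d := depth_mono (leqnSn e : pos e <= pos_succ e).
    have neq_p : p (pos e) != p (pos_succ e).
      by rewrite (inj_eq perm_inj) -val_eqE /= neq_ltn leqnn.
    have := desc e; have := depth_lt (pos e) (pos_succ e).
    rewrite inE barred_lt.
    move: le_d neq_p; rewrite /before /letter -val_eqE.
    by case: (pos e < p _); case: (pos_succ e < p _) => /=; lia.
  (* [before] is transitive, so adjacent pairs suffice by induction on [j]. *)
  case: j => j; elim: j => // j IHj lt_jn lt_ij.
  have lt_jn1 : j < n.-1 by lia.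
  have := adj (Ordinal lt_jn1).
  have -> : pos_succ (Ordinal lt_jn1) = Ordinal lt_jn by apply: val_inj.
  have [eij|neq_ij] := eqVneq i (pos (Ordinal lt_jn1)); first by rewrite eij.
  have lt_j : j < n by lia.
  have -> : pos (Ordinal lt_jn1) = Ordinal lt_j by apply: val_inj.
  have := IHj lt_j; move: neq_ij lt_ij; rewrite -val_eqE /before /=; lia.
move=> cp; apply/forall_inP => e; rewrite inE barred_lt.
have := depth_lt (pos e) (pos_succ e).
have := cp (pos e) (pos_succ e) (ltnSn e); rewrite /letter.
by case: (pos e < p _); case: (pos_succ e < p _) => /=; lia.
Qed.

End Compatibility.

(** * Coefficients as cardinalities, and their symmetry *)

Lemma F_sort n (S : {set 'I_n.-1}) (m : monomial) :
  F S m = F_index S (sort geq m).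
Proof.
congr Posz; set s := sort geq m.
have geq_anti : antisymmetric geq by move=> x y; lia.
have geq_trans : transitive geq by move=> x y z; lia.
have geq_total : total geq by move=> x y; lia.
(* Only the weakly decreasing rearrangement of [m] can be counted. *)
rewrite (@eq_in_count _ _ (fun x => (x == s) && F_index S s)) => [|x].
  case: (F_index S s); last first.
    by rewrite (eq_count (a2 := pred0)) ?count_pred0 // => x; rewrite andbF.
  rewrite (eq_count (a2 := pred1 s)) => [|x]; last by rewrite andbT.
  rewrite count_uniq_mem ?permutations_uniq //.
  by rewrite mem_permutations perm_sort perm_refl.
rewrite mem_permutations => pxm; apply/idP/andP => [Fx|[/eqP->]//].
suff -> : s = x by rewrite eqxx.
have [_ sorted_x _ _] := and4P Fx.
apply: (sorted_eq geq_trans geq_anti) => //; first exact: sort_sorted.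
by rewrite perm_sort perm_sym.
Qed.

Definition compatible_perms n la (s : seq nat) j : {set 'S_n} :=
  [set p | [&& cycle_type p == la, exc p == j & F_index (Exd p) s]].

Lemma Q_card n la j m :
  Q n la j m = #|compatible_perms n la (sort geq m) j|.
Proof.
rewrite /Q -sum1_card (eq_bigr _ (fun p _ => F_sort _ _)).
rewrite -(big_morph Posz PoszD (erefl _)); congr Posz.
rewrite big_mkcond [RHS]big_mkcond; apply: eq_bigr => p _.
by rewrite inE; do 2!case: eqP => //= _; case: (F_index _ _).
Qed.

Lemma leq_card_compatible_perms n la s j :
  #|compatible_perms n la s j| <=
  #|compatible_perms n la s (n - count_mem 1 la - j)|.
Proof.
(* Any member certifies that [s] is a weakly decreasing word of length [n] with positive entries. *)
have [->|[p0]] := set_0Vmem (compatible_perms n la s j).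
  by rewrite cards0.
rewrite inE => /and3P[_ _ /and4P[/eqP size_s sorted_s s_gt0 _]].
pose d := depth (n := n) s; have d_mono := depth_mono size_s sorted_s.
have compatP p := F_index_compatible size_s sorted_s p s_gt0.
have flip_inj_in : {in compatible_perms n la s j &, injective (flip d)}.
  move=> p q; rewrite !inE => /and3P[_ _ /compatP cp] /and3P[_ _ /compatP cq].
  exact: flip_inj.
rewrite -(card_in_imset flip_inj_in).
apply/subset_leq_card/subsetP => _ /imsetP[p + ->].
rewrite !inE => /and3P[/eqP type_p /eqP exc_p /compatP cp].
apply/and3P; split; last exact/compatP/compatible_flip.
  by rewrite cycle_typeJ cycle_typeV type_p.
by rewrite excE card_exc_flip // -type_p -card_exc_antiexc -excE exc_p addKn.
Qed.

Theorem theorem5p5 (n k : nat) (la : seq nat)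
    (la_partition : is_partition n la) (la_ones : count_mem 1 la = k)
    (j : nat) (le_j : j <= n - k) :
  Q n la j = Q n la (n - k - j).
Proof.
apply: functional_extensionality => m; rewrite !Q_card; congr Posz.
apply/eqP; rewrite eqn_leq -la_ones leq_card_compatible_perms /=.
(* The same inequality at [n - k - j]; [le_j] makes the truncated subtraction return to [j]. *)
rewrite -{2}(subKn le_j) -la_ones; apply: leq_card_compatible_perms.
Qed.
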